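(* Let $F=(k_F)_{k\ge 0}$ be a sequence of positive integers and let $\Pi$ be the $F$-cobweb poset, with levels $\Phi_0,\Phi_1,\Phi_2,\dots$ and $|\Phi_k|=k_F$. Let $\mu$ be the Möbius function of $\Pi$. Then for all $r,s\in\mathbb{N}\cup\{0\}$, all $x\in\Phi_r$ and all $y\in\Phi_s$ with $x\le y$, the value $\mu(x,y)$ depends only on $r$ and $s$, and $$\mu(x,y)=c_{r,s}=[s=r]-[s=r+1]+[s>r+1]\,(-1)^{s-r}\prod_{i=r+1}^{s-1}(i_F-1).$$
   Context: An $F$-cobweb poset is a partially ordered set $\Pi=(\Phi,\le)$ whose ground set is the disjoint union $\Phi=\bigcup_{k\ge 0}\Phi_k$ of finite nonempty sets (levels) with $|\Phi_k|=k_F$, in which each level is an antichain and, for $x\in\Phi_r$, $y\in\Phi_s$ with $r\neq s$, one has $x<y$ if and only if $r<s$. (Equivalently, $\Pi$ is the ordinal sum $\Phi_0\oplus\Phi_1\oplus\Phi_2\oplus\cdots$ of trivially ordered sets.) The Möbius function is defined recursively by $\mu(x,x)=1$ and $\mu(x,y)=-\sum_{x\le z<y}\mu(x,z)$ for $x<y$. Here $[P]$ denotes $1$ if the statement $P$ is true and $0$ otherwise. *)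

(* Defs.v *)
From mathcomp Require Import all_boot all_order all_algebra.
From mathcomp Require Import mathcomp_extra boolp classical_sets functions.
From mathcomp Require Import cardinality fsbigop.

Set Implicit Arguments.
Unset Strict Implicit.
Unset Printing Implicit Defensive.

Import Order.TTheory GRing.Theory Num.Theory.
Local Open Scope classical_set_scope.
Local Open Scope ring_scope.

Definition antichain (d : Order.disp_t) (T : porderType d) (A : set T) : Prop :=
  forall x y : T, A x -> A y -> (x <= y)%O -> x = y.

(* Nonemptiness of the levels is the positivity of F, which is kept as a      *)
(* separate hypothesis on F.                                                  *)
Record cobweb (F : nat -> nat) (d : Order.disp_t) (T : porderType d)
    (Phi : nat -> set T) : Prop := Cobweb {
  cobweb_cover : \bigcup_k Phi k = [set: T];
  cobweb_disjoint : trivIset [set: nat] Phi;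
  cobweb_card : forall k : nat, (Phi k #= `I_(F k))%card;
  cobweb_antichain : forall k : nat, antichain (Phi k);
  cobweb_lt : forall (r s : nat) (x y : T), r <> s -> Phi r x -> Phi s y ->
    (x < y)%O <-> (r < s)%N }.

(* The sum is a finitely supported one, so this is meaningful only when the   *)
(* intervals of T are finite, as they are in a cobweb poset. The values of mu *)
(* at pairs with ~~ (x <= y) are unconstrained.                               *)
Definition mobius (d : Order.disp_t) (T : porderType d) (mu : T -> T -> int) :
    Prop :=
  (forall x : T, mu x x = 1) /\
  (forall x y : T, (x < y)%O ->
     mu x y = - \sum_(z \in [set z | (x <= z < y)%O]) mu x z).

(* Main.v *)
(** For s > r and x in level r, the half-open interval from x to a point of
    level s + 1 is the disjoint union of the interval from x to a point y of
    level s and of the whole level s. The sum of mu(x, -) over the former is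
    - mu(x, y), and every point of level s contributes mu(x, y), so going from
    level s to level s + 1 multiplies mu(x, -) by -(s_F - 1). *)

Require Import Defs.
From mathcomp Require Import all_boot all_order all_algebra.
From mathcomp Require Import mathcomp_extra boolp classical_sets functions.
From mathcomp Require Import cardinality fsbigop.
From mathcomp Require Import ring.

Set Implicit Arguments.
Unset Strict Implicit.
Unset Printing Implicit Defensive.

Import Order.TTheory GRing.Theory Num.Theory.
Local Open Scope classical_set_scope.
Local Open Scope ring_scope.

Lemma fsum_const (I : choiceType) (V : nmodType) (A : set I) (n : nat) (c : V) :
  (A #= `I_n)%card -> \sum_(i \in A) c = c *+ n.
Proof.
move=> An; rewrite fsbig_finite; last by exists n.
by rewrite big_const_seq count_predT (card_fset_set An) iter_addr_0.
Qed.

(** [cobweb_lt] only compares distinct levels; for [r = s] both sides are false, by the antichain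
    property. *)
Lemma cobweb_ltE (F : nat -> nat) (d : Order.disp_t) (T : porderType d)
    (Phi : nat -> set T) (r s : nat) (x y : T) :
  cobweb F Phi -> Phi r x -> Phi s y -> (x < y)%O = (r < s)%N.
Proof.
move=> cobwebT rx sy; case: (eqVneq r s) => [rs|/eqP rs]; last first.
  by apply/idP/idP => /(cobweb_lt cobwebT rs rx sy).
rewrite rs ltnn; apply/negbTE/negP; rewrite lt_neqAle => /andP[/eqP xy lexy].
by rewrite rs in rx; exact: xy (cobweb_antichain cobwebT rx sy lexy).
Qed.

Lemma cobweb_leE (F : nat -> nat) (d : Order.disp_t) (T : porderType d)
    (Phi : nat -> set T) (r s : nat) (x y : T) :
  cobweb F Phi -> Phi r x -> Phi s y -> (x <= y)%O = (x == y) || (r < s)%N.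
Proof. by move=> cobwebT rx sy; rewrite le_eqVlt (cobweb_ltE cobwebT rx sy). Qed.

Lemma cobweb_level (F : nat -> nat) (d : Order.disp_t) (T : porderType d)
    (Phi : nat -> set T) (z : T) :
  cobweb F Phi -> exists k, Phi k z.
Proof.
move=> cobwebT; have : (\bigcup_k Phi k) z by rewrite (cobweb_cover cobwebT).
by case=> k _ kz; exists k.
Qed.

Lemma cobweb_nonempty (F : nat -> nat) (d : Order.disp_t) (T : porderType d)
    (Phi : nat -> set T) (k : nat) :
  cobweb F Phi -> (0 < F k)%N -> Phi k !=set0.
Proof.
move=> cobwebT Fk; apply/set0P/negP => /eqP Phik0.
have := cobweb_card cobwebT k; rewrite Phik0 card_eq_sym card_eq0 => /eqP I0.
by have : `I_(F k) 0%N by []; rewrite I0.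
Qed.

(** Base case of the inductions on the upper level: no level fits strictly between [r] and [r.+1],
    and the other points of level [r] are incomparable to [x]. *)
Lemma cobweb_itvS (F : nat -> nat) (d : Order.disp_t) (T : porderType d)
    (Phi : nat -> set T) (r : nat) (x y : T) :
  cobweb F Phi -> Phi r x -> Phi r.+1 y ->
  [set z | (x <= z < y)%O] = [set x].
Proof.
move=> cobwebT rx Sy; apply/seteqP; split=> z /=; last first.
  by move=> ->; rewrite lexx (cobweb_ltE cobwebT rx Sy) ltnSn.
have [k kz] := cobweb_level z cobwebT.
rewrite (cobweb_leE cobwebT rx kz) (cobweb_ltE cobwebT kz Sy) ltnS.
by case/andP => /orP[/eqP->//|rk]; rewrite leqNgt rk.
Qed.

(** A point below [y'] has level at most [s]. Those of smaller level are below [y] as well, and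
    since [r < s] all of level [s] lies above [x]. *)
Lemma cobweb_itv_step (F : nat -> nat) (d : Order.disp_t) (T : porderType d)
    (Phi : nat -> set T) (r s : nat) (x y y' : T) :
  cobweb F Phi -> (r < s)%N -> Phi r x -> Phi s y -> Phi s.+1 y' ->
  [set z | (x <= z < y')%O] = [set z | (x <= z < y)%O] `|` Phi s.
Proof.
move=> cobwebT rs rx sy Sy'; apply/seteqP; split=> z /=;
  have [k kz] := cobweb_level z cobwebT;
  rewrite (cobweb_leE cobwebT rx kz) (cobweb_ltE cobwebT kz Sy');
  rewrite (cobweb_ltE cobwebT kz sy) ltnS.
  case/andP => ->; rewrite leq_eqVlt => /orP[/eqP ks|->]; last by left.
  by right; rewrite -ks.
case=> [/andP[-> /ltnW ->]//|sz].
have -> : k = s by apply: (cobweb_disjoint cobwebT) => //; exists z.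
by rewrite rs orbT leqnn.
Qed.

Lemma cobweb_itv_disj (F : nat -> nat) (d : Order.disp_t) (T : porderType d)
    (Phi : nat -> set T) (s : nat) (x y : T) :
  cobweb F Phi -> Phi s y ->
  [set z | (x <= z < y)%O] `&` Phi s `<=` set0.
Proof.
move=> cobwebT sy z [/= /andP[_ zy] sz].
by move: zy; rewrite (cobweb_ltE cobwebT sz sy) ltnn.
Qed.

(** Needed to split the finitely supported sum over the union given by [cobweb_itv_step]. *)
Lemma cobweb_itv_finite (F : nat -> nat) (d : Order.disp_t) (T : porderType d)
    (Phi : nat -> set T) (r s : nat) (x y : T) :
  (forall k, (0 < F k)%N) -> cobweb F Phi -> (r < s)%N -> Phi r x -> Phi s y ->
  finite_set [set z | (x <= z < y)%O].
Proof.
move=> F_gt0 cobwebT + rx; elim: s y => // s IHs y.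
rewrite ltnS leq_eqVlt => /orP[/eqP <- Sy|rs Sy].
  by rewrite (cobweb_itvS cobwebT rx Sy); exact: finite_set1.
have [w sw] := cobweb_nonempty cobwebT (F_gt0 s).
rewrite (cobweb_itv_step cobwebT rs rx sw Sy) finite_setU; split.
  exact: IHs.
by exists (F s); exact: (cobweb_card cobwebT).
Qed.

Lemma mobius_cobweb_lt (F : nat -> nat) (d : Order.disp_t) (T : porderType d)
    (Phi : nat -> set T) (mu : T -> T -> int) (r s : nat) (x y : T) :
  (forall k, (0 < F k)%N) -> cobweb F Phi -> mobius mu ->
  (r < s)%N -> Phi r x -> Phi s y ->
  mu x y = (-1) ^+ (s - r) * \prod_(r.+1 <= i < s) ((F i)%:Z - 1).
Proof.
(* The endpoint [y] is generalized so that the induction hypothesis applies to every point of level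
   [s]. *)
move=> F_gt0 cobwebT [mu1 muE] + rx; elim: s y => // s IHs y rs Sy.
rewrite muE ?(cobweb_ltE cobwebT rx Sy)//.
move: rs; rewrite ltnS leq_eqVlt => /orP[/eqP rs|rs].
  rewrite -rs in Sy *.
  by rewrite (cobweb_itvS cobwebT rx Sy) fsbig_set1 mu1 subSnn big_geq ?mulr1.
(* Any [w] in level [s] serves as the reference endpoint for the recursion. *)
have [w sw] := cobweb_nonempty cobwebT (F_gt0 s).
have levelF := cobweb_card cobwebT s.
rewrite (cobweb_itv_step cobwebT rs rx sw Sy) fsbigU0; first last.
- exact: cobweb_itv_disj cobwebT sw.
- by exists (F s).
- exact: cobweb_itv_finite F_gt0 cobwebT rs rx sw.
(* The recursion at [w], read backwards, turns the sum over the smaller interval into [- mu x w]. *)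
rewrite /= -[X in X + _]opprK -muE ?(cobweb_ltE cobwebT rx sw)//.
rewrite (eq_fsbigr (fun=> mu x w)); last first.
  by move=> z; rewrite inE => sz; rewrite (IHs z) ?(IHs w).
(* What remains is [- (- mu x w + F s * mu x w)]: one more sign, and the new last factor [F s - 1]
   of the product. *)
rewrite (fsum_const _ levelF) (IHs w)// big_nat_recr//= subSn ?(ltnW rs)// exprS.
by rewrite -mulr_natr natz; ring.
Qed.

Theorem theorem3 (F : nat -> nat) (F_gt0 : forall k : nat, (0 < F k)%N)
    (d : Order.disp_t) (T : porderType d) (Phi : nat -> set T)
    (cobwebT : cobweb F Phi)
    (mu : T -> T -> int) (mobius_mu : mobius mu) (r s : nat) :
  (forall x x' y y' : T, Phi r x -> Phi r x' -> Phi s y -> Phi s y' ->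
     (x <= y)%O -> (x' <= y')%O -> mu x y = mu x' y') /\
  (forall x y : T, Phi r x -> Phi s y -> (x <= y)%O ->
     mu x y = (s == r)%:R - (s == r.+1)%:R
              + (r.+1 < s)%N%:R
                * ((-1) ^+ (s - r) * \prod_(r.+1 <= i < s) ((F i)%:Z - 1))).
Proof.
set c := (X in forall x y, _ -> _ -> _ -> _ = X).
(* As [c] involves neither point, the formula also gives the independence claim. *)
suff muE x y : Phi r x -> Phi s y -> (x <= y)%O -> mu x y = c.
  by split=> // x x' y y' *; rewrite !muE.
move=> rx sy; rewrite le_eqVlt => /orP[/eqP xy|].
  have sr : s = r.
    apply: (cobweb_disjoint cobwebT) => //.
    by exists x; split; rewrite // xy.
  rewrite /c sr -xy (proj1 mobius_mu) eqxx ltn_eqF// ltnNge leqnSn.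
  by rewrite mul0r subr0 addr0.
rewrite (cobweb_ltE cobwebT rx sy) => rs.
rewrite (mobius_cobweb_lt F_gt0 cobwebT mobius_mu rs rx sy) /c (gtn_eqF rs).
(* For [s = r.+1] the product is empty and the sign is [-1], which is the second indicator term. *)
case: (ltngtP s r.+1) => [|rs'|->]; first by rewrite ltnNge rs.
  by rewrite mul1r subr0 add0r.
by rewrite subSnn big_geq// mul0r addr0 mulr1 sub0r.
Qed.
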